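(* Let $n\ge 2$, let $z_1,\dots,z_n$ be distinct complex numbers, and let $a_1,\dots,a_n>0$ with $\sum_{i=1}^n a_i=1$. Let $w_1,\dots,w_{n-1}$ be the zeros, counted with multiplicity, of $f(z)=\sum_{i=1}^n\frac{a_i}{z-z_i}$. Put $\mathcal{Z}=\{z_1,\dots,z_n\}$, $\mathcal{W}=\{w_1,\dots,w_{n-1}\}$, $\zeta=\sum_{i=1}^n a_iz_i$, $\mathcal{W}_e=\mathcal{W}\cup\{\zeta\}$, and $\sigma_2(\mathbf{z};\mathbf{a})=\big(\sum_{i=1}^n a_i|z_i-\zeta|^2\big)^{1/2}$. Then $$h(\mathcal{W},\mathcal{Z})\le h(\mathcal{W}_e,\mathcal{Z})\le\sigma_2(\mathbf{z};\mathbf{a}).$$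
   Context: For non-empty sets $\Omega_1,\Omega_2\subset\mathbb{C}$, the relative (directed) Hausdorff distance from $\Omega_1$ to $\Omega_2$ is $h(\Omega_1,\Omega_2)=\sup_{w\in\Omega_1}\inf_{z\in\Omega_2}|w-z|$. *)

(* Defs.v *)
From HB Require Import structures.
From mathcomp Require Import all_boot all_order all_algebra.
From mathcomp Require Import complex.
From mathcomp Require Import all_classical all_reals ereal.

Set Implicit Arguments.
Unset Strict Implicit.
Unset Printing Implicit Defensive.

Import Order.TTheory GRing.Theory Num.Theory.

Local Open Scope classical_set_scope.
Local Open Scope ring_scope.
Local Open Scope complex_scope.

Local Notation "x %:F" := (@FracField.tofrac _ x) : ring_scope.

(* The complex numbers are R[i] with R : realType. The norm `|x| of R[i] takes
   its values in R[i]; cmod x is the same modulus as an element of R. *)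
Definition cmod (R : realType) (x : R[i]) : R := ComplexField.Normc.normc x.

(* Extended-real valued, so that the supremum makes sense for unbounded sets. *)
Definition hausdorff_dist (R : realType) (A B : set R[i]) : \bar R :=
  ereal_sup [set ereal_inf [set (cmod (w - z))%:E | z in B] | w in A].

Definition pole_sum (R : realType) (n : nat) (a : 'I_n -> R)
    (z : 'I_n -> R[i]) : {fraction {poly R[i]}} :=
  \sum_(i < n) ((a i)%:C%:P)%:F / ('X - (z i)%:P)%:F.

(* Order exactly m at x; since m is a natural number, no m qualifies when x is
   a pole, and m = 0 means that f is regular and nonzero at x. *)
Definition has_order_at (R : realType) (f : {fraction {poly R[i]}}) (x : R[i])
    (m : nat) : Prop :=
  exists p q : {poly R[i]},
    [/\ p.[x] != 0, q.[x] != 0 & f = (('X - x%:P) ^+ m * p)%:F / q%:F].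

(* The restriction to m > 0 is needed because the poles of f also have
   multiplicity 0 in w. *)
Definition zeros_with_multiplicity (R : realType) (f : {fraction {poly R[i]}})
    (k : nat) (w : 'I_k -> R[i]) : Prop :=
  forall (x : R[i]) (m : nat), (0 < m)%N ->
    #|[pred j | w j == x]| = m <-> has_order_at f x m.

Definition wmean (R : realType) (n : nat) (a : 'I_n -> R) (z : 'I_n -> R[i]) :
    R[i] :=
  \sum_(i < n) (a i)%:C * z i.

Definition sigma2 (R : realType) (n : nat) (a : 'I_n -> R)
    (z : 'I_n -> R[i]) : R :=
  Num.sqrt (\sum_(i < n) a i * cmod (z i - wmean a z) ^+ 2).

(* Main.v *)
(* Let x be a zero of f that is not a pole, u_i = x - z_i, and s = min |u_i|^2.
   Conjugating f(x) = 0 gives sum a_i u_i / |u_i|^2 = 0, so the vectors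
   v_i = (1 - s / |u_i|^2) u_i have the same weighted mean x - zeta as the u_i.
   By Jensen, |x - zeta|^2 <= sum a_i |v_i|^2, and |v_i|^2 <= |u_i|^2 - s since
   s <= |u_i|^2; this says that s is at most the weighted variance of the u_i,
   which is sigma_2^2. *)
Require Import Defs.
From HB Require Import structures.
From mathcomp Require Import all_boot all_order all_algebra.
From mathcomp Require Import complex.
From mathcomp Require Import all_classical all_reals ereal.
From mathcomp Require Import ring lra.

Set Implicit Arguments.
Unset Strict Implicit.
Unset Printing Implicit Defensive.

Import Order.TTheory GRing.Theory Num.Theory.

Local Open Scope classical_set_scope.
Local Open Scope ring_scope.
Local Open Scope complex_scope.

Local Notation "x %:F" := (@FracField.tofrac _ x) : ring_scope.

Lemma weighted_variance (R : realFieldType) (n : nat) (a y : 'I_n -> R) :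
  \sum_(i < n) a i = 1 ->
  \sum_(i < n) a i * (y i - \sum_(j < n) a j * y j) ^+ 2 =
  \sum_(i < n) a i * y i ^+ 2 - (\sum_(i < n) a i * y i) ^+ 2.
Proof.
move=> a1; set m := \sum_(j < n) a j * y j.
rewrite (eq_bigr (fun i => a i * y i ^+ 2 - (2 * m) * (a i * y i) + m ^+ 2 * a i));
  last by move=> i _; ring.
by rewrite big_split /= sumrB -!mulr_sumr a1 -/m; ring.
Qed.

(** Jensen for the square: the two sides differ by a weighted variance. *)
Lemma sqr_weighted_mean_le (R : realFieldType) (n : nat) (a y : 'I_n -> R) :
  (forall i, 0 < a i) -> \sum_(i < n) a i = 1 ->
  (\sum_(i < n) a i * y i) ^+ 2 <= \sum_(i < n) a i * y i ^+ 2.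
Proof.
move=> a0 a1; rewrite -subr_ge0 -weighted_variance //.
by apply: sumr_ge0 => i _; rewrite mulr_ge0 ?sqr_ge0 ?ltW.
Qed.

(** Here [b i] and [c i] stand for the coordinates of [u_i], so [q i] is [|u_i|^2] and the two
    vanishing sums are the coordinates of the conjugated equation [f(x) = 0]. Jensen is applied to
    each coordinate separately. *)
Lemma planar_variance_ge (R : realFieldType) (n : nat) (a b c : 'I_n -> R) (s : R) :
  let q i := b i ^+ 2 + c i ^+ 2 in
  (forall i, 0 < a i) -> \sum_(i < n) a i = 1 ->
  0 < s -> (forall i, s <= q i) ->
  \sum_(i < n) a i * (b i / q i) = 0 -> \sum_(i < n) a i * (c i / q i) = 0 ->
  s <= \sum_(i < n) a i * q i
       - (\sum_(i < n) a i * b i) ^+ 2 - (\sum_(i < n) a i * c i) ^+ 2.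
Proof.
move=> q a0 a1 s0 sq b0 c0.
have q0 i : 0 < q i by exact: lt_le_trans (sq i).
have shrink (y : 'I_n -> R) : \sum_(i < n) a i * (y i / q i) = 0 ->
    \sum_(i < n) a i * y i = \sum_(i < n) a i * ((1 - s / q i) * y i).
  move=> y0; rewrite [RHS](eq_bigr (fun i => a i * y i - s * (a i * (y i / q i))));
    last by move=> i _; ring.
  by rewrite sumrB -mulr_sumr y0 mulr0 subr0.
have Jb := sqr_weighted_mean_le (fun i => (1 - s / q i) * b i) a0 a1.
have Jc := sqr_weighted_mean_le (fun i => (1 - s / q i) * c i) a0 a1.
rewrite -shrink // in Jb; rewrite -shrink // in Jc.
(* Spreading [s] over the weights reduces the claim to a comparison term by term. *)
have -> : s = \sum_(i < n) a i * s by rewrite -mulr_suml a1 mul1r.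
rewrite -addrA -opprD lerBrDr -lerBrDl -sumrB.
apply: le_trans (lerD Jb Jc) _; rewrite -big_split /=.
apply: ler_sum => i _; rewrite -mulrDr -mulrBr ler_pM2l //.
(* The left side is [|v_i|^2 = (1 - s / q i)^2 * q i]; the last term subtracted on the right is
   nonnegative because [s <= q i]. *)
have -> : ((1 - s / q i) * b i) ^+ 2 + ((1 - s / q i) * c i) ^+ 2
        = q i - s - s * (1 - s / q i).
  rewrite /q; field; exact: lt0r_neq0 (q0 i).
by rewrite gerBl mulr_ge0 ?(ltW s0) // subr_ge0 ler_pdivrMr // mul1r.
Qed.

Section Complex.
Variable R : realType.
Implicit Types (x y : R[i]) (n : nat).

Lemma Re_sum n (u : 'I_n -> R[i]) :
  complex.Re (\sum_(i < n) u i) = \sum_(i < n) complex.Re (u i).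
Proof. by apply: big_morph => // -[? ?] [? ?]. Qed.

Lemma Im_sum n (u : 'I_n -> R[i]) :
  complex.Im (\sum_(i < n) u i) = \sum_(i < n) complex.Im (u i).
Proof. by apply: big_morph => // -[? ?] [? ?]. Qed.

Lemma cmod_sqr x : cmod x ^+ 2 = complex.Re x ^+ 2 + complex.Im x ^+ 2.
Proof. by case: x => b c; rewrite /cmod /= sqr_sqrtr // addr_ge0 ?sqr_ge0. Qed.

Lemma cmod_ge0 x : 0 <= cmod x.
Proof. by case: x => b c; exact: sqrtr_ge0. Qed.

Lemma cmodN x : cmod (- x) = cmod x.
Proof. by case: x => b c; rewrite /cmod /= !sqrrN. Qed.

Lemma Re_realM (r : R) x : complex.Re (r%:C * x) = r * complex.Re x.
Proof. by case: x => b c /=; rewrite mul0r subr0. Qed.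

Lemma Im_realM (r : R) x : complex.Im (r%:C * x) = r * complex.Im x.
Proof. by case: x => b c /=; rewrite mul0r addr0. Qed.

Lemma Re_wmean n (a : 'I_n -> R) (u : 'I_n -> R[i]) :
  complex.Re (wmean a u) = \sum_(i < n) a i * complex.Re (u i).
Proof. by rewrite Re_sum; apply: eq_bigr => i _; rewrite Re_realM. Qed.

Lemma Im_wmean n (a : 'I_n -> R) (u : 'I_n -> R[i]) :
  complex.Im (wmean a u) = \sum_(i < n) a i * complex.Im (u i).
Proof. by rewrite Im_sum; apply: eq_bigr => i _; rewrite Im_realM. Qed.

Lemma sigma2_variance n (a : 'I_n -> R) (u : 'I_n -> R[i]) :
  \sum_(i < n) a i = 1 ->
  \sum_(i < n) a i * cmod (u i - wmean a u) ^+ 2 =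
  \sum_(i < n) a i * cmod (u i) ^+ 2
    - complex.Re (wmean a u) ^+ 2 - complex.Im (wmean a u) ^+ 2.
Proof.
move=> a1; rewrite Re_wmean Im_wmean.
under eq_bigr => i _.
  rewrite cmod_sqr (_ : complex.Re _ = complex.Re (u i) - complex.Re (wmean a u));
    last by case: (u i) (wmean a u) => ? ? [].
  rewrite (_ : complex.Im _ = complex.Im (u i) - complex.Im (wmean a u));
    last by case: (u i) (wmean a u) => ? ? [].
  rewrite Re_wmean Im_wmean mulrDr; over.
under [in RHS]eq_bigr => i _ do rewrite cmod_sqr mulrDr.
by rewrite !big_split /= !weighted_variance //; ring.
Qed.

(** As the weights sum to 1, the mean commutes with the reflection [z -> x - z], so deviations from
    it only change sign. Hence the [u_i] and the [z_i] have the same variance. *)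
Lemma cmod_sub_wmean n (a : 'I_n -> R) (z : 'I_n -> R[i]) x i :
  \sum_(j < n) a j = 1 ->
  cmod ((x - z i) - wmean a (fun j => x - z j)) = cmod (z i - wmean a z).
Proof.
move=> a1; rewrite -cmodN; congr cmod.
have -> : wmean a (fun j => x - z j) = x - wmean a z.
  rewrite /wmean; under eq_bigr do rewrite mulrBr.
  by rewrite sumrB -mulr_suml -rmorph_sum /= a1 mul1r.
by ring.
Qed.

Lemma zero_near_some_pole n (a : 'I_n -> R) (z : 'I_n -> R[i]) x :
  (0 < n)%N -> (forall i, 0 < a i) -> \sum_(i < n) a i = 1 ->
  (forall i, x != z i) -> \sum_(i < n) (a i)%:C / (x - z i) = 0 ->
  exists i, cmod (x - z i) ^+ 2 <= \sum_(j < n) a j * cmod (z j - wmean a z) ^+ 2.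
Proof.
move=> n0 a0 a1 xz fx0; pose u i := x - z i.
(* [z k] is a pole nearest to [x], and [s] will be [cmod (u k) ^+ 2]. *)
have /(_ (Ordinal n0) isT)[k _ kmin] :=
  @arg_minP _ _ _ _ xpredT (fun i => cmod (u i)).
exists k; under eq_bigr do rewrite -(cmod_sub_wmean z x _ a1).
rewrite sigma2_variance // Re_wmean Im_wmean.
under eq_bigr do rewrite cmod_sqr.
have fx0' : \sum_(i < n) (a i)%:C * (u i)^-1 = 0 by [].
apply: planar_variance_ge => //.
- rewrite exprn_gt0 // lt_neqAle cmod_ge0 andbT eq_sym.
  by apply: contra (xz k) => /eqP/ComplexField.Normc.eq0_normc/eqP; rewrite subr_eq0.
- by move=> i; rewrite -cmod_sqr ler_pXn2r ?nnegrE ?cmod_ge0 //; exact: kmin.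
- rewrite -[RHS](congr1 (@complex.Re R) fx0') Re_sum; apply: eq_bigr => i _.
  by rewrite Re_realM -/(u i); case: (u i).
(* The inverse of [u] has imaginary part [- Im u / |u|^2], hence the change of sign. *)
- apply/eqP; rewrite -oppr_eq0 -sumrN; apply/eqP.
  rewrite -[RHS](congr1 (@complex.Im R) fx0') Im_sum; apply: eq_bigr => i _.
  by rewrite Im_realM -/(u i) -mulrN; case: (u i).
Qed.

(** The least of the [|zeta - z_i|^2] is at most their weighted average, which is the variance. *)
Lemma wmean_near_some_pole n (a : 'I_n -> R) (z : 'I_n -> R[i]) :
  (0 < n)%N -> (forall i, 0 < a i) -> \sum_(i < n) a i = 1 ->
  exists i, cmod (wmean a z - z i) ^+ 2 <=
            \sum_(j < n) a j * cmod (z j - wmean a z) ^+ 2.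
Proof.
move=> n0 a0 a1.
have /(_ (Ordinal n0) isT)[k _ kmin] :=
  @arg_minP _ _ _ _ xpredT (fun i => cmod (wmean a z - z i)).
exists k; rewrite -[leLHS]mul1r -a1 mulr_suml; apply: ler_sum => i _.
rewrite ler_pM2l // -[in leRHS]cmodN opprB.
by rewrite ler_pXn2r ?nnegrE ?cmod_ge0 //; exact: kmin.
Qed.

Lemma tofrac_neq0 (q : {poly R[i]}) x : q.[x] != 0 -> q%:F != 0.
Proof. by rewrite tofrac_eq0; apply: contraNneq => ->; rewrite horner0. Qed.

(** Links the formal fraction to the numerical sum: away from the poles, some representative has a
    denominator nonzero at [x], and evaluating it gives that sum. *)
Lemma pole_sum_eval n (a : 'I_n -> R) (z : 'I_n -> R[i]) x :
  (forall i, x != z i) ->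
  exists p q : {poly R[i]}, [/\ q.[x] != 0, pole_sum a z = p%:F / q%:F &
    \sum_(i < n) (a i)%:C / (x - z i) = p.[x] / q.[x]].
Proof.
move=> xz; rewrite /pole_sum.
(* [K f v] says that [f] is regular at [x] with value [v], a relation stable under addition. *)
pose K (f : {fraction {poly R[i]}}) (v : R[i]) := exists p q : {poly R[i]},
  [/\ q.[x] != 0, f = p%:F / q%:F & v = p.[x] / q.[x]].
apply: (big_ind2 K).
- by exists 0, 1; rewrite hornerC oner_neq0 horner0 !mul0r.
- move=> _ _ _ _ [p [q [qx -> ->]]] [p' [q' [qx' -> ->]]].
  exists (p * q' + p' * q), (q * q').
  rewrite !hornerE mulf_neq0 // -!addf_div ?(@tofrac_neq0 _ x) // tofracD !tofracM.
  by split=> //; rewrite addf_div ?(@tofrac_neq0 _ x).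
- move=> i _; exists (a i)%:C%:P, ('X - (z i)%:P).
  by rewrite !hornerE subr_eq0 xz.
Qed.

(** Equate the two representations of [f], cross-multiply and evaluate at [x]: the factor
    [('X - x)^m] vanishes as [m > 0], which forces [p'.[x] = 0]. *)
Lemma pole_sum_zero n (a : 'I_n -> R) (z : 'I_n -> R[i]) x m :
  (0 < m)%N -> has_order_at (pole_sum a z) x m -> (forall i, x != z i) ->
  \sum_(i < n) (a i)%:C / (x - z i) = 0.
Proof.
move=> m0 [p [q [_ qx fE]]] /(pole_sum_eval a)[p' [q' [qx' fE' ->]]].
move: fE'; rewrite fE => /eqP; rewrite eqr_div ?(@tofrac_neq0 _ x) // -!tofracM tofrac_eq.
move=> /eqP/(congr1 (horner^~ x)); rewrite !hornerE subrr expr0n gtn_eqF //= !mul0r.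
by move=> /esym/eqP; rewrite mulf_eq0 (negPf qx) orbF => /eqP ->; rewrite mul0r.
Qed.

End Complex.

Theorem theorem4 (R : realType) (n : nat) (z : 'I_n -> R[i]) (a : 'I_n -> R)
    (w : 'I_n.-1 -> R[i]) :
  (2 <= n)%N ->
  injective z ->
  (forall i, 0 < a i) ->
  \sum_(i < n) a i = 1 ->
  zeros_with_multiplicity (pole_sum a z) w ->
  let Z := range z in
  let W := range w in
  let We := W `|` [set wmean a z] in
  (hausdorff_dist W Z <= hausdorff_dist We Z)%E /\
  (hausdorff_dist We Z <= (sigma2 a z)%:E)%E.
Proof.
move=> n2 _ a0 a1 wP Z W We; have n0 : (0 < n)%N by exact: ltn_trans n2.
split; first by apply/ereal_sup_le/image_subset; exact: subsetUl.
apply: ge_ereal_sup => _ [x xWe <-].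
(* The infimum over [Z] is at most the distance to any single pole. *)
suff [i le_i] : exists i, cmod (x - z i) ^+ 2 <=
    \sum_(j < n) a j * cmod (z j - wmean a z) ^+ 2.
  apply: (@le_trans _ _ (cmod (x - z i))%:E).
    by apply: ereal_inf_lbound; exists (z i) => //; exists i.
  by rewrite lee_fin -(ger0_norm (cmod_ge0 _)) -sqrtr_sqr ler_wsqrtr.
case: xWe => [[j _ <-]|->]; last exact: wmean_near_some_pole.
have [i /eqP wz|wz] := pickP [pred i | w j == z i].
  exists i; rewrite wz subrr cmod_sqr /= expr0n addr0.
  by apply: sumr_ge0 => k _; rewrite mulr_ge0 ?sqr_ge0 ?ltW.
have {}wz i : w j != z i by rewrite -[_ == _]/([pred i | w j == z i] i) wz.
apply: zero_near_some_pole => //.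
(* The multiplicity of [w j] in the family counts [j] itself, so [wP] applies to it. *)
have m0 : (0 < #|[pred k | w k == w j]|)%N.
  by apply/card_gt0P; exists j; rewrite inE.
by apply: (pole_sum_zero m0) => //; exact/wP.
Qed.
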